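(* Let $S\subseteq\mathbb N$ be a numerical semigroup with multiplicity $m$, conductor $c$, minimal generating set $P$, and let $L=\{s\in S: s<c\}$. If $|P|\ge m/3$, then $|P|\,|L|\ge c$.
   Context: A numerical semigroup is a subset $S\subseteq\mathbb N=\{0,1,2,\dots\}$ containing $0$, closed under addition, with finite complement in $\mathbb N$. Let $S^*=S\setminus\{0\}$. The multiplicity is $m=\min S^*$, the Frobenius number is $f=\max(\mathbb Z\setminus S)$ and the conductor is $c=f+1$. The minimal generating set (set of primitive elements) is $P=S^*\setminus(S^*+S^* )$, where $S^*+S^*=\{x+y: x,y\in S^*\}$. The inequality $|P||L|\ge c$ is Wilf's conjecture. *)

(* Defs.v *)
From mathcomp Require Import all_boot.
Set Implicit Arguments. Unset Strict Implicit. Unset Printing Implicit Defensive.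

Definition numerical_semigroup (S : pred nat) : Prop :=
  [/\ S 0,
      (forall x y, S x -> S y -> S (x + y)) &
      exists N, forall n, N <= n -> S n].

Definition is_multiplicity (S : pred nat) (m : nat) : Prop :=
  [/\ 0 < m, S m & forall s, 0 < s -> S s -> m <= s].

(* c is the conductor f + 1, f = max (Z \ S): the least c with [c, oo) in S.
   (Negative integers are never in S, so f >= -1 and c >= 0.) *)
Definition is_conductor (S : pred nat) (c : nat) : Prop :=
  (forall n, c <= n -> S n) /\ (forall c', (forall n, c' <= n -> S n) -> c <= c').

Definition primitive (S : pred nat) (x : nat) : Prop :=
  [/\ 0 < x, S x & ~ exists y z, [/\ 0 < y, 0 < z, S y, S z & x = y + z]].

(* Main.v *)
Require Import Defs.
From mathcomp Require Import all_boot zify.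

(* Work with the set X of nonzero Apery elements of S with respect to m, which
   has m - 1 elements: |P| - 1 primitive ones and d = m - |P| decomposable ones.
   Let w x be the number of elements of L congruent to x modulo m and at least x,
   q = w 0, W the sum of w over X, and rho = q m - c.  Then |L| = q + W, and the
   theorem reads q d <= |P| W + rho.

   If a, b and a + b are in X then w a + w b >= q, except that for the at most
   rho elements a + b of [c + m - rho, c + m) one only gets q - 1.  So, up to the
   error rho, each decomposable element can be charged q units of the weight of
   two summands; it has to be shown that no element of X is charged more than
   |P| times.

   If no sum of three primitives, not all equal, is in X, the decomposable
   elements are the sums of two distinct primitives, and the multiples i a with
   2 <= i <= t (t depending on a).  Charging a + b to {a, b}, t a to
   {a, (t - 1) a}, and i a with 1 < i < t to {i a, (t - i) a} charges a primitive
   at most |P| times and its multiples twice.  The loss of 1 on i a with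
   1 < i < t, which is not accounted for by rho, is absorbed by the weight of i a
   when |P| >= 3; when |P| = 2 the residues modulo m of the i a bound the losses.

   Otherwise the summands of a mixed sum of three primitives have weight at least
   3 (q - 1) or 2 (q - 1).  As d <= 2 |P|, one is done when W >= 2 q; this leaves
   the case 2a + b in X, where the elements of X below c are a, b, 2a, a + b and
   at most one more, of weight 1.  Then d <= 8, and comparing residues modulo m
   gives rho >= 4, which is enough. *)

Set Implicit Arguments.
Unset Strict Implicit.
Unset Printing Implicit Defensive.

(** * Comparison of sums over lists *)

(** The fibres of [g] over distinct elements of [s] are disjoint, and each contains a [y] with [G y]
    at least [F x]. This is the charging principle: [G y] pays for [g y]. *)
Lemma leq_sum_cover (I J : eqType) (s : seq I) (s' : seq J) (g : J -> I)
    (F : I -> nat) (G : J -> nat) :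
  uniq s -> (forall x, x \in s -> exists2 y, y \in s' & g y = x /\ F x <= G y) ->
  \sum_(x <- s) F x <= \sum_(y <- s') G y.
Proof.
move=> us cov.
have -> : \sum_(x <- s) F x = \sum_(x <- s | x \in s) F x by rewrite -big_seq.
apply: (@leq_trans (\sum_(x <- s | x \in s) \sum_(y <- s' | g y == x) G y)).
  apply: leq_sum => x /cov [y ys' [gy Fx]].
  by rewrite (big_rem y) //= gy eqxx; apply: leq_trans Fx (leq_addr _ _).
rewrite -big_seq (exchange_big_dep predT) //= leq_sum // => y _.
rewrite (eq_bigl (pred1 (g y))); last by move=> i; rewrite /= eq_sym.
rewrite -big_filter big_const_seq count_predT iter_addn_0 -[X in _ <= X]muln1.
by rewrite leq_mul2l size_filter count_uniq_mem // leq_b1 orbT.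
Qed.

Lemma leq_sum_sub (s t : seq nat) (F : nat -> nat) :
  uniq s -> {subset s <= t} -> \sum_(x <- s) F x <= \sum_(x <- t) F x.
Proof.
by move=> us st; apply: (leq_sum_cover (g := id)) => // x /st xt; exists x.
Qed.

(* [lia] case-splits on every boolean hypothesis, so the non-arithmetic ones are
   discarded first. *)
Ltac arith :=
  repeat match goal with
  | H : is_true ?b |- _ =>
    lazymatch b with
    | leq _ _ => fail
    | negb (eq_op _ _) => fail
    | _ => clear H
    end
  end; lia.

(** * Progressions modulo [m] and Apery elements *)

Section Apery.

Variables m c : nat.
Hypotheses (m_gt0 : 0 < m) (c_gt0 : 0 < c).

(* The number of elements below [c] in the progression [x, x + m, x + 2m, ...]. *)
Definition wt x := (c - x + m.-1) %/ m.

Definition depth := wt 0.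

Definition rho := depth * m - c.

Lemma wt_ge x : c <= x + wt x * m.
Proof.
rewrite /wt; have := divn_eq (c - x + m.-1) m.
by have := ltn_pmod (c - x + m.-1) m_gt0; lia.
Qed.

Lemma wt_lt x : wt x * m < c - x + m.
Proof. by rewrite /wt; have := divn_eq (c - x + m.-1) m; lia. Qed.

Lemma wt_gt0 x : x < c -> 0 < wt x.
Proof. by move=> xc; have := wt_ge x; case: (wt x) => //; lia. Qed.

Lemma depth_gt0 : 0 < depth. Proof. exact: wt_gt0. Qed.

Lemma depthE : depth * m = c + rho.
Proof. by rewrite /rho; have := wt_ge 0; rewrite -/depth; lia. Qed.

Lemma rho_lt : rho < m.
Proof. by have := wt_lt 0; rewrite -/depth depthE; lia. Qed.

Variable S : pred nat.
Hypotheses (S0 : S 0) (SD : forall x y, S x -> S y -> S (x + y)).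
Hypotheses (Sm : S m) (m_min : forall s, 0 < s -> S s -> m <= s).
Hypothesis Sc : forall n, c <= n -> S n.

(** The guard [m <= x] matters: for [x < m] the truncated [x - m] is 0, which lies in [S]. *)
Definition apery : pred nat :=
  fun x => [&& 0 < x, S x & ~~ ((m <= x) && S (x - m))].

Definition aps := [seq x <- iota 0 (c + m) | apery x].

Definition prim : pred nat :=
  fun x => [&& 0 < x, S x & ~~ has (fun y => S y && S (x - y)) (iota 1 x.-1)].

Lemma apery_lt x : apery x -> x < c + m.
Proof.
case/and3P=> _ _; apply: contraNltn => le; rewrite Sc; lia.
Qed.

Lemma mem_aps x : (x \in aps) = apery x.
Proof.
rewrite mem_filter mem_iota add0n /= andb_idr // => /apery_lt; lia.
Qed.

Lemma uniq_aps : uniq aps.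
Proof. by rewrite filter_uniq ?iota_uniq. Qed.

Lemma apery_gt x : apery x -> m < x.
Proof.
case/and3P=> x0 Sx nS; rewrite ltn_neqAle m_min // andbT.
by apply: contraNneq nS => <-; rewrite leqnn subnn S0.
Qed.

Lemma apery_summand x y : S y -> 0 < y -> S x -> apery (y + x) -> apery y.
Proof.
move=> Sy y0 Sx /and3P[_ _ nS]; apply/and3P; split=> //.
apply: contra nS => /andP[my Sym].
have -> : y + x - m = (y - m) + x by lia.
by rewrite SD // andbT; lia.
Qed.

Lemma semigroup_aperyD x y : apery x -> apery y -> S (x + y).
Proof. by case/and3P=> _ Sx _ /and3P[_ Sy _]; apply: SD. Qed.

Lemma semigroup_mul x k : S x -> S (k * x).
Proof. by move=> Sx; elim: k => // k IH; rewrite mulSn SD. Qed.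

Lemma apery_addl x y z :
  apery x -> apery y -> apery z -> apery (x + y + z) -> apery (x + y).
Proof.
move=> Ax Ay Az; apply: apery_summand; first exact: semigroup_aperyD.
  by have := apery_gt Ax; lia.
by case/and3P: Az.
Qed.

Lemma apery_summand_lt x y : apery y -> apery (x + y) -> x < c.
Proof. by move=> /apery_gt my /apery_lt; lia. Qed.

(** * Weights of two summands of an Apery element *)

Definition high z : bool := c + m <= z + rho.

(** By [wt_ge], [(wt x + wt y) * m >= 2c - (x + y)]. This exceeds [c - m = (depth - 1) * m - rho],
    and even [(depth - 1) * m] when [x + y] is not high. *)
Lemma wtD x y : apery (x + y) -> depth <= wt x + wt y + high (x + y).
Proof.
move=> /apery_lt lt; have := wt_ge x; have := wt_ge y; have := depthE.
have := rho_lt.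
move=> h1 h2 h3 h4; rewrite leqNgt; apply/negP.
rewrite -(leq_pmul2r m_gt0) mulSn !mulnDl /high; case: leqP => h /=; lia.
Qed.

Lemma sum_high : \sum_(x <- aps) high x <= rho.
Proof.
have -> : \sum_(x <- aps) high x = size [seq x <- aps | high x].
  rewrite size_filter -sum1_count [RHS]big_mkcond.
  by apply: eq_bigr => x _; case: high.
rewrite -[leqRHS](size_iota (c + m - rho)).
apply: uniq_leq_size; first by rewrite filter_uniq ?uniq_aps.
move=> x; rewrite mem_filter mem_iota mem_aps /high => /andP[h /apery_lt].
by have := rho_lt; lia.
Qed.

(* [res x] is the representative of [x - c] modulo [m] in [0, m), when [x < c]. *)
Definition res x := wt x * m + x - c.

Lemma apery_mod x y : apery x -> apery y -> x = y %[mod m] -> x = y.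
Proof.
suff wl u v : apery u -> apery v -> u < v -> u = v %[mod m] -> False.
  by move=> Ax Ay e; case: (ltngtP x y) => // h; [case: (wl x y)|case: (wl y x)].
move=> Au Av uv /eqP; rewrite eq_sym eqn_mod_dvd ?(ltnW uv) // => /dvdnP[k e].
case/and3P: Av => _ _ /negP; apply.
case: k e => [|k] e; first lia.
have -> : v - m = u + k * m by nia.
have -> /= : m <= v by nia.
by apply: SD; [case/and3P: Au | apply: semigroup_mul].
Qed.

Lemma res_inj x y : apery x -> apery y -> res x = res y -> x = y.
Proof.
rewrite /res => Ax Ay e; apply: apery_mod => //.
have := wt_ge x; have := wt_ge y => h1 h2.
have e' : wt x * m + x = wt y * m + y by lia.
by have := congr1 (modn^~ m) e'; rewrite /= !modnMDl.
Qed.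

(** Here [res x + res y = (wt x + wt y) * m + (x + y) - 2c] is at most [rho + (x + y) - (c + m)]. As
    [res] is injective on Apery elements, this limits how many pairs can fall short of [depth]. *)
Lemma weak_res x y : apery (x + y) -> apery x -> apery y ->
  wt x + wt y < depth -> res x + res y < rho.
Proof.
move=> Axy /[dup] Ax /apery_gt gx /[dup] Ay /apery_gt gy lt.
have := apery_lt Axy; have := wt_ge x; have := wt_ge y; have := depthE.
rewrite /res => h1 h2 h3 h4; nia.
Qed.

(** * Cardinalities of the Apery set, of L and of P *)

Lemma size_aps : (size aps).+1 = m.
Proof.
(* Sliding the window [[n, n + m)] by one gains an element of [S] exactly when [n + m] is an Apery
   element. At [n = c] the window is full. *)
have F n : count S (iota n m) = (count apery (iota m n)).+1.
  elim: n => [|n IH].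
    case: m m_gt0 m_min => // k _ kmin; rewrite /= S0 -{2}[1]addn0; congr (_ + _).
    apply/eqP; rewrite -leqn0 leqNgt -has_count; apply/hasP => -[x].
    by rewrite mem_iota => /andP[x0 lx] /(kmin _ x0); lia.
  have e : count S (iota n m.+1) = S n + count S (iota n.+1 m) by [].
  have : count S (iota n m.+1) = count S (iota n m) + S (n + m).
    by rewrite -addn1 iotaD count_cat /= addn0.
  rewrite {}e IH (_ : iota m n.+1 = rcons (iota m n) (m + n)); last first.
    by rewrite -addn1 iotaD cats1.
  rewrite -cats1 count_cat /= addn0.
  have -> : apery (m + n) = S (n + m) && ~~ S n.
    by rewrite /apery addn_gt0 m_gt0 leq_addr addKn addnC.
  case Sn: (S n) => /=; last by lia.
  by rewrite SD //; lia.
have := F c; rewrite (_ : count S _ = m); last first.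
  rewrite -[RHS](size_iota c); apply/eqP; rewrite -all_count; apply/allP => x.
  by rewrite mem_iota => /andP[/Sc].
move=> ->; congr _.+1; rewrite size_filter addnC iotaD count_cat add0n.
rewrite [X in X + _](_ : _ = 0) //; apply/eqP; rewrite -leqn0 leqNgt -has_count.
by apply/hasP => -[x]; rewrite mem_iota => lx /apery_gt; lia.
Qed.

(** The progressions of step [m] from 0 and from the Apery elements are disjoint modulo [m]; the one
    from [x] has [wt x] terms below [c], none when [x >= c]. *)
Lemma size_small (L : seq nat) : (forall x, S x -> x < c -> x \in L) ->
  depth + \sum_(x <- aps) wt x <= size L.
Proof.
move=> LP.
have mod_inj : {in 0 :: aps &, forall x y, x = y %[mod m] -> x = y}.
  have z x : apery x -> x = 0 %[mod m] -> False.
    move=> /[dup] Ax /apery_gt gx /eqP; rewrite mod0n => /dvdnP[k e].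
    case/and3P: Ax => _ _ /negP[]; rewrite (ltnW gx) /=.
    by have -> : x - m = k.-1 * m by [case: k e => [|k]; lia]; exact: semigroup_mul.
  move=> x y; rewrite !inE !mem_aps => /predU1P[->|Ax] /predU1P[->|Ay] //.
  - by move=> /esym /(z _ Ay).
  - by move=> /(z _ Ax).
  - exact: apery_mod.
pose s := [seq x + j * m | x <- 0 :: aps, j <- iota 0 (wt x)].
have us : uniq s.
  apply: allpairs_uniq_dep.
  - rewrite /= uniq_aps mem_aps andbT; apply/negP => /apery_gt; lia.
  - by move=> x _; apply: iota_uniq.
  move=> u v /allpairsPdep[x [i [xs _ ->]]] /allpairsPdep[y [j [ys _ ->]]] /= e.
  have exy : x = y.
    apply: mod_inj => //; have := congr1 (modn^~ m) e.
    by rewrite /= ![_ + _ * m]addnC !modnMDl.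
  by subst y; congr (Tagged _ _); apply/eqP; rewrite -(eqn_pmul2r m_gt0); lia.
have -> : depth + \sum_(x <- aps) wt x = size s.
  rewrite size_allpairs_dep sumnE big_map big_cons size_iota; congr (_ + _).
  by apply: eq_bigr => x _; rewrite size_iota.
apply: uniq_leq_size => // _ /allpairsPdep[x [j [xs js ->]]].
apply: LP.
  apply: SD (semigroup_mul _ Sm); move: xs; rewrite inE mem_aps.
  by case/predU1P=> [->//|/and3P[]].
move: js; rewrite mem_iota /= add0n => js; have := wt_lt x.
have: j.+1 * m <= wt x * m by rewrite leq_pmul2r.
by rewrite mulSn; case: (ltnP x c) => xc; nia.
Qed.

Lemma primP x : reflect (primitive S x) (prim x).
Proof.
apply: (iffP and3P) => -[x0 Sx nx]; split=> //.
  move=> [y [z [y0 z0 Sy Sz e]]]; case/hasP: nx; exists y; first by rewrite mem_iota; lia.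
  by rewrite Sy e addKn.
apply/hasP => -[y]; rewrite mem_iota => ly /andP[Sy Sz]; apply: nx.
by exists y, (x - y); split=> //; lia.
Qed.

Lemma prim_apery x : prim x -> x != m -> apery x.
Proof.
move=> /primP[x0 Sx nx] xm; apply/and3P; split=> //; apply/negP => /andP[mx Sxm].
by apply: nx; exists m, (x - m); split=> //; lia.
Qed.

Lemma prim_mult : prim m.
Proof.
apply/primP; split=> // -[y [z [y0 z0 Sy Sz e]]].
by have := m_min y0 Sy; lia.
Qed.

(** The least nonzero proper summand [a] of [x] is primitive, since a summand of [a] would be a
    smaller summand of [x]. *)
Lemma apery_decomp x : apery x -> ~~ prim x ->
  exists a y, [/\ prim a, apery a, apery y & x = a + y].
Proof.
move=> Ax; have /and3P[x0 Sx _] := Ax.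
rewrite /prim x0 Sx /= negbK => /hasP[y0]; rewrite mem_iota => ly0 /andP[Sy0 Sxy0].
have ex : exists y, [&& 0 < y < x, S y & S (x - y)].
  by exists y0; rewrite Sy0 Sxy0 andbT; lia.
case: (ex_minnP ex) => a /and3P[/andP[a0 ax] Sa Sxa] amin {ly0 Sy0 Sxy0 ex}.
have e : a + (x - a) = x by rewrite subnKC // ltnW.
have Aa : apery a by apply: (@apery_summand (x - a)); rewrite // e.
have Ab : apery (x - a).
  by apply: (@apery_summand a) => //; rewrite ?subn_gt0 // addnC e.
exists a, (x - a); split=> //.
apply/primP; split=> // -[y [z [y0' z0 Sy Sz eyz]]].
have ya : y < a by move: eyz z0; clear; lia.
suff /amin : [&& 0 < y < x, S y & S (x - y)] by rewrite leqNgt ya.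
have -> : x - y = z + (x - a) by move: eyz ax; clear; lia.
by rewrite Sy SD // y0' (ltn_trans ya ax).
Qed.

Definition gens := [seq x <- aps | prim x].
Definition decs := [seq x <- aps | ~~ prim x].
Definition weight := \sum_(x <- aps) wt x.

Lemma mem_gens x : (x \in gens) = prim x && apery x.
Proof. by rewrite mem_filter mem_aps. Qed.

Lemma mem_decs x : (x \in decs) = ~~ prim x && apery x.
Proof. by rewrite mem_filter mem_aps. Qed.

Lemma size_gens_decs : (size gens).+1 + size decs = m.
Proof. by rewrite !size_filter addSn count_predC size_aps. Qed.

Lemma size_prims (P : seq nat) : uniq P -> (forall x, x \in P <-> primitive S x) ->
  size P = (size gens).+1.
Proof.
move=> uP PP; have um : uniq (m :: gens).
  rewrite /= filter_uniq ?uniq_aps // andbT mem_gens.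
  by apply/negP => /andP[_ /apery_gt]; rewrite ltnn.
apply/eqP; rewrite -[_.+1]/(size (m :: gens)); apply/eqP/perm_size/uniq_perm => // x.
rewrite inE mem_gens; apply/idP/idP => [/PP/primP px|].
  by case: eqP => //= /eqP xm; rewrite px prim_apery.
by case/predU1P=> [->|/andP[px _]]; apply/PP/primP => //; exact: prim_mult.
Qed.

Lemma prim_neqD x y z : prim x -> apery y -> apery z -> x <> y + z.
Proof.
case/primP=> _ _ nx /and3P[y0 Sy _] /and3P[z0 Sz _] e.
by apply: nx; exists y, z.
Qed.

Lemma leq_weight (s : seq nat) : uniq s -> {in s, forall x, apery x} ->
  \sum_(x <- s) wt x <= weight.
Proof. by move=> us sA; apply: leq_sum_sub => // x /sA; rewrite mem_aps. Qed.

(** * Mixed sums of three primitives *)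

Lemma size_decs_heavy : size decs <= 2 * (size gens).+1 -> 2 * depth <= weight ->
  depth * size decs <= (size gens).+1 * weight + rho.
Proof. by nia. Qed.

(** Needed because [3 * (depth - 1) >= 2 * depth] means [depth >= 3]. *)
Lemma depth_gt2 x y : apery x -> apery y -> x + y < c -> 2 < depth.
Proof.
move=> /apery_gt gx /apery_gt gy lc; have := wt_ge 0; rewrite -/depth.
by rewrite ltnNge => h; apply/negP => h2; nia.
Qed.

(** The three splittings into one primitive and the sum of the other two involve six distinct
    elements, and each pair weighs at least [depth - 1]. *)
Lemma distinct_triple_heavy a b e : prim a -> prim b -> prim e ->
  apery a -> apery b -> apery e -> a != b -> b != e -> a != e ->
  apery (a + b + e) -> 2 * depth <= weight.
Proof.
move=> pa pb pe Aa Ab Ae ab be ae Aabe.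
have Aab := apery_addl Aa Ab Ae Aabe.
have Aae : apery (a + e) by apply: (@apery_addl a e b) => //; rewrite addnAC.
have Abe : apery (b + e).
  by apply: (@apery_addl b e a) => //; rewrite addnC addnA.
have d3 : 2 < depth by apply: (depth_gt2 Aa Ab); apply: (apery_summand_lt Ae).
have := @leq_weight [:: a; b; e; b + e; a + e; a + b].
rewrite !big_cons big_nil => /(_ _ _)/=.
have w1 : depth <= wt (a + b) + wt e + 1.
  by apply: leq_trans (wtD Aabe) _; rewrite leq_add2l leq_b1.
have w2 : depth <= wt a + wt (b + e) + 1.
  by rewrite -addnA in Aabe; apply: leq_trans (wtD Aabe) _; rewrite leq_add2l leq_b1.
have w3 : depth <= wt b + wt (a + e) + 1.
  have A3 : apery (b + (a + e)) by rewrite addnCA addnA.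
  by apply: leq_trans (wtD A3) _; rewrite leq_add2l leq_b1.
have n1 := @prim_neqD _ _ _ pa Ab Ae; have n2 := @prim_neqD _ _ _ pb Aa Ae.
have n3 := @prim_neqD _ _ _ pe Aa Ab; have ga := apery_gt Aa; have gb := apery_gt Ab.
have ge := apery_gt Ae.
move=> h; suff : 3 * depth <= weight + 3 by arith.
have {}h : wt a + (wt b + (wt e + (wt (b + e) + (wt (a + e) + (wt (a + b) + 0))))) <= weight.
  apply: h; first by rewrite !inE; arith.
  by move=> x; rewrite !inE; do 5 (case/orP => [/eqP->//|]); move/eqP->.
arith.
Qed.

(* All proper sub-sums of an Apery element lie below [c], so when [E] lists
   what else than [a, b, 2a, a + b] lies there, few sums can be Apery. *)
Lemma decs_mixed (E : seq nat) a b x : prim a -> prim b -> apery a -> apery b ->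
  a != b -> apery (a + a + b) ->
  {in E, forall e, [/\ apery e, e != a & e != b]} ->
  {in E &, forall e e', e = e'} ->
  (forall y, apery y -> y < c -> y \in [:: a; b; a + a; a + b] ++ E) ->
  x \in decs ->
  x \in [:: a + a; a + b; b + b; a + a + a; a + a + b] ++
        flatten [seq [:: a + e; b + e; e + e] | e <- E].
Proof.
move=> pa pb Aa Ab ab Aaab EA E1 EP.
have Aaa := apery_addl Aa Aa Ab Aaab.
have Aab : apery (a + b) by apply: (@apery_addl a b a) => //; rewrite addnAC.
have cl s t z : apery s -> apery t -> apery z -> apery (s + t + z) ->
    s + t \in [:: a; b; a + a; a + b] ++ E.
  move=> As At Az A3; apply: EP; first exact: apery_addl A3.
  exact: apery_summand_lt A3.
have ga := apery_gt Aa; have gb := apery_gt Ab.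
have a_bb := prim_neqD pa Ab Ab; have b_aa := prim_neqD pb Aa Aa.
have a_e e : e \in E -> b <> a + e by case/EA => Ae _ _; apply: prim_neqD.
have b_aaa : b <> a + (a + a) by apply: prim_neqD.
have L5 y : y \in [:: a + a; a + b; b + b; a + a + a; a + a + b] ->
    y \in [:: a + a; a + b; b + b; a + a + a; a + a + b] ++
          flatten [seq [:: a + e; b + e; e + e] | e <- E].
  by move=> h; rewrite mem_cat h.
have LE e y : e \in E -> y \in [:: a + e; b + e; e + e] ->
    y \in [:: a + a; a + b; b + b; a + a + a; a + a + b] ++
          flatten [seq [:: a + e; b + e; e + e] | e <- E].
  by move=> eE h; rewrite mem_cat; apply/orP; right; apply/flatten_mapP; exists e.
have inE4 y : y \in [:: a; b; a + a; a + b] ++ E ->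
    y != a -> y != b -> y != a + a -> y != a + b -> y \in E.
  rewrite mem_cat !inE => /orP[|//]; arith.
have aaE : apery (a + a + a + a) -> a + a + a \in E.
  move=> A4; apply: inE4; [apply: (cl (a + a) a a) => // | arith | arith | arith | arith].
(* Below [c], [a + e] would be listed, yet it differs from [a], [b], [2a], [a + b] and from [e], the
   only element of [E]. *)
have e_a e : e \in E -> apery (a + e) -> a + e < c -> False.
  move=> eE A lt; have := EP _ A lt; have [Ae ea eb] := EA e eE.
  rewrite mem_cat => /orP[|/(E1 e _ eE)]; last by arith.
  by have := a_e e eE; have := apery_gt Ae; rewrite !inE; arith.
have Ce e v : e \in E -> v \in [:: a; b; a + a; a + b] ++ E -> apery (e + v) ->
    e + v \in [:: a + a; a + b; b + b; a + a + a; a + a + b] ++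
          flatten [seq [:: a + e; b + e; e + e] | e <- E].
  move=> eE; have [Ae ea eb] := EA e eE.
  rewrite mem_cat => /orP[|/(E1 e _ eE)<- _]; last first.
    by apply: (LE e) => //; rewrite !inE; arith.
  rewrite !inE => /or4P[] /eqP-> A.
  - by apply: (LE e) => //; rewrite !inE; arith.
  - by apply: (LE e) => //; rewrite !inE; arith.
  - rewrite addnA in A; case: (e_a e eE); rewrite addnC.
      exact: apery_addl A.
    exact: apery_summand_lt A.
  - rewrite addnA in A; case: (e_a e eE); rewrite addnC.
      exact: apery_addl A.
    exact: apery_summand_lt A.
have CB u v : u \in [:: a; b; a + a; a + b] -> v \in [:: a; b; a + a; a + b] ->
    apery (u + v) ->
    u + v \in [:: a + a; a + b; b + b; a + a + a; a + a + b] ++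
          flatten [seq [:: a + e; b + e; e + e] | e <- E].
  have c1 : apery (b + b + a) -> b + b \in E.
    by move=> A; apply: inE4; [exact: (cl b b a) | arith | arith | arith | arith].
  (* An Apery [3a + b] would put both [3a] and [2a + b] in [E]; below, [2a + 2b] would do so with
     [2a + b] and [a + 2b]. *)
  have c3 : apery (a + a + (a + b)) -> False.
    move=> A.
    have h1 : a + a + a \in E.
      apply: inE4; [|arith|arith|arith|arith]; apply: (cl (a + a) a b) => //.
      by rewrite -addnA.
    have h2 : a + b + a \in E.
      apply: inE4; [|arith|arith|arith|arith]; apply: (cl (a + b) a a) => //.
      by rewrite -addnA addnC.
    by have := E1 _ _ h1 h2; arith.
  have c4 : apery (a + b + (a + b)) -> False.
    move=> A.
    have h1 : a + b + a \in E.
      apply: inE4; [|arith|arith|arith|arith]; apply: (cl (a + b) a b) => //.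
      by rewrite -addnA.
    have h2 : a + b + b \in E.
      apply: inE4; [|arith|arith|arith|arith]; apply: (cl (a + b) b a) => //.
      by rewrite -addnA (addnC b).
    by have := E1 _ _ h1 h2; arith.
  have aux : forall k, u + v = k -> apery (u + v) -> apery k by move=> k <-.
  rewrite !inE => /or4P[] /eqP ? /or4P[] /eqP ? A; subst u v;
    try by (apply: L5; rewrite !inE; arith).
  - by apply: (LE (b + b)); [apply: c1; apply: aux A; arith | rewrite !inE; arith].
  - by apply: (LE (a + a + a)); [apply: aaE; apply: aux A; arith | rewrite !inE; arith].
  - by case: c3.
  - by apply: (LE (b + b)); [apply: c1; apply: aux A; arith | rewrite !inE; arith].
  - by case: c3; apply: aux A; arith.
  - by case: c4.
rewrite mem_decs => /andP[np Ax].
have [u [v [_ Au Av e]]] := apery_decomp Ax np; subst x.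
have hu : u \in [:: a; b; a + a; a + b] ++ E.
  by apply: EP => //; apply: (apery_summand_lt Av).
have hv : v \in [:: a; b; a + a; a + b] ++ E.
  by apply: EP => //; apply: (@apery_summand_lt _ u) => //; rewrite addnC.
have /orP[uB|uE] : (u \in [:: a; b; a + a; a + b]) || (u \in E) by rewrite -mem_cat.
  have /orP[vB|vE] : (v \in [:: a; b; a + a; a + b]) || (v \in E) by rewrite -mem_cat.
    exact: CB.
  by rewrite addnC; apply: Ce => //; rewrite addnC.
exact: Ce.
Qed.

Lemma mixed_bound a b : prim a -> prim b -> apery a -> apery b ->
  a != b -> apery (a + a + b) -> size decs <= 2 * (size gens).+1 ->
  depth * size decs <= (size gens).+1 * weight + rho.
Proof.
move=> pa pb Aa Ab ab Aaab dec2.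
have Aaa := apery_addl Aa Aa Ab Aaab.
have Aaba : apery (a + b + a) by rewrite addnAC.
have Aab := apery_addl Aa Ab Aa Aaba.
have d3 : 2 < depth by apply: (depth_gt2 Aa Ab); apply: (apery_summand_lt Aa).
have [|lt] := leqP (2 * depth) weight; first exact: size_decs_heavy.
have ga := apery_gt Aa; have gb := apery_gt Ab.
have a_bb := prim_neqD pa Ab Ab; have b_aa := prim_neqD pb Aa Aa.
have w1 : depth <= wt (a + a) + wt b + 1.
  by apply: leq_trans (wtD Aaab) _; rewrite leq_add2l leq_b1.
have w2 : depth <= wt (a + b) + wt a + 1.
  by apply: leq_trans (wtD Aaba) _; rewrite leq_add2l leq_b1.
pose B := [:: a; b; a + a; a + b].
pose E := [seq x <- aps | (x \notin B) && (x < c)].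
have EP x : (x \in E) = [&& x \notin B, x < c & apery x].
  by rewrite mem_filter mem_aps andbA.
have uE : uniq E by rewrite filter_uniq ?uniq_aps.
have sz : wt a + wt b + wt (a + a) + wt (a + b) + size E <= weight.
  have uB : uniq (B ++ E).
    rewrite cat_uniq uE andbT; apply/andP; split; first by rewrite /= !inE; arith.
    by apply/hasPn => x; rewrite EP => /and3P[].
  have BE : {in B ++ E, forall x, apery x}.
    move=> x; rewrite mem_cat EP !inE => /orP[|/and3P[] //].
    by case/or4P=> /eqP->.
  apply: leq_trans (leq_weight uB BE).
  rewrite big_cat /= !big_cons big_nil addn0 !addnA leq_add2l.
  rewrite -sum1_size big_seq_cond [leqRHS]big_seq_cond.
  by apply: leq_sum => x; rewrite andbT EP => /and3P[_ /wt_gt0].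
have gens2 : 2 <= size gens.
  have : {subset [:: a; b] <= gens}.
    by move=> x; rewrite !inE mem_gens => /orP[] /eqP->; rewrite ?pa ?pb.
  by move/uniq_leq_size; apply; rewrite /= inE ab.
(* The pairs [2a, b] and [a + b, a] already weigh [2 * depth - 2], while [weight < 2 * depth]. *)
have E1 : size E <= 1 by arith.
have decsub := @decs_mixed E a b _ pa pb Aa Ab ab Aaab.
have sdec : size decs <= 5 + 3 * size E.
  pose l := [:: a + a; a + b; b + b; a + a + a; a + a + b] ++
        flatten [seq [:: a + e; b + e; e + e] | e <- E].
  have -> : 5 + 3 * size E = size l.
    by rewrite size_cat; case: (E) E1 => [|e [|]].
  apply: uniq_leq_size; first by rewrite filter_uniq ?uniq_aps.
  move=> x; apply: decsub.
  - by move=> e; rewrite EP /B !inE => /and3P[+ _ Ae]; rewrite !negb_or => /and4P[].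
  - by case: (E) E1 => [|e [|]] // _ u v; rewrite !inE => /eqP-> /eqP->.
  - move=> y Ay yc; rewrite mem_cat EP Ay yc -/B andbT.
    by case: (y \in B).
(* Here the two splittings [(2a) + b] and [(a + b) + a] involve four distinct residues. *)
have rho4 : wt (a + a) + wt b < depth -> wt (a + b) + wt a < depth -> 4 <= rho.
  move=> l1 l2; have := weak_res Aaab Aaa Ab l1; have := weak_res Aaba Aab Aa l2.
  have i1 : res a <> res b by move/(res_inj Aa Ab); arith.
  have i2 : res a <> res (a + a) by move/(res_inj Aa Aaa); arith.
  have i3 : res a <> res (a + b) by move/(res_inj Aa Aab); arith.
  have i4 : res b <> res (a + a) by move/(res_inj Ab Aaa); arith.
  have i5 : res b <> res (a + b) by move/(res_inj Ab Aab); arith.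
  have i6 : res (a + a) <> res (a + b) by move/(res_inj Aaa Aab); arith.
  (* Four distinct naturals sum to at least 6, and both pair sums are at most [rho - 1]. *)
  arith.
have : weight.+1 = 2 * depth \/ weight.+2 = 2 * depth /\ size E = 0.
  arith.
(* If one pair reaches [depth], then [weight >= 2 * depth - 1 + size E], which empties [E]. *)
have : 4 <= rho \/ size E = 0 /\ weight.+1 = 2 * depth.
  case: (ltnP (wt (a + a) + wt b) depth) => l1; last by right; arith.
  case: (ltnP (wt (a + b) + wt a) depth) => l2; last by right; arith.
  by left; exact: rho4.
(* The tight cases have [size E = 1] and [size decs] 6 or 8 with 3 or 4 primitives:
   [weight = 2 * depth - 1] falls short by one per primitive, and [rho >= 4] makes up for it. *)
move: (size E) (size decs) (size gens) weight depth E1 sdec dec2 gens2 d3.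
clear; nia.
Qed.

(** * Multiples of a primitive and the unmixed case *)

Definition top a := \max_(i < c + m | apery (i * a)) i.

Lemma apery_mul a i j : apery a -> 0 < j <= i -> apery (i * a) -> apery (j * a).
Proof.
move=> Aa /andP[j0 ji]; rewrite -(subnKC ji) mulnDl.
have Sa : S a by case/and3P: Aa.
apply: apery_summand; try exact: semigroup_mul.
by have := apery_gt Aa; rewrite muln_gt0 j0; arith.
Qed.

Lemma leq_top a i : apery (i * a) -> i <= top a.
Proof.
move=> Aia; have lt := apery_lt Aia.
have a0 : 0 < a by case: a Aia lt => //; rewrite muln0.
have ilt : i < c + m by apply: leq_ltn_trans lt; rewrite leq_pmulr.
exact: (@leq_bigmax_cond _ (fun i : 'I_(c + m) => apery (i * a)) val (Ordinal ilt)).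
Qed.

Lemma top_gt0 a : apery a -> 0 < top a.
Proof. by move=> Aa; apply: leq_top; rewrite mul1n. Qed.

Lemma apery_top a : apery a -> apery (top a * a).
Proof.
move=> Aa; have lt : 1 < c + m by move: c_gt0 m_gt0; clear; lia.
have ne : 0 < #|[pred i : 'I_(c + m) | apery (i * a)]|.
  by apply/card_gt0P; exists (Ordinal lt); rewrite inE /= mul1n.
rewrite /top; have [i] := eq_bigmax_cond val ne.
by rewrite inE => Ai ->.
Qed.

Lemma apery_le_top a i : apery a -> 0 < i <= top a -> apery (i * a).
Proof. by move=> Aa h; apply: apery_mul h (apery_top Aa). Qed.

Lemma wtD_top a i : apery a -> 0 < i < top a ->
  depth <= wt (i * a) + wt ((top a - i) * a) + high (top a * a).
Proof.
move=> Aa /andP[_ it]; have e : i * a + (top a - i) * a = top a * a.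
  by rewrite -mulnDl subnKC // ltnW.
by rewrite -e; apply: wtD; rewrite e; exact: apery_top.
Qed.

Lemma wt_lt_top a i : apery a -> 0 < i < top a -> 0 < wt (i * a).
Proof.
move=> Aa /andP[i0 it]; apply/wt_gt0/(apery_summand_lt Aa).
by rewrite addnC -mulSn; apply: apery_le_top.
Qed.

Lemma sum_wt_rev a t :
  \sum_(1 <= i < t) wt ((t - i) * a) = \sum_(1 <= i < t) wt (i * a).
Proof. by rewrite [RHS]big_nat_rev; apply: eq_bigr => i _; rewrite add1n subSS. Qed.

Definition unmixed := forall a b e, prim a -> prim b -> prim e ->
  apery a -> apery b -> apery e -> apery (a + b + e) -> a = b /\ b = e.

(** Strong induction, splitting off a primitive [a]: a rest [b + d] with [b < d] would give a mixed
    triple, and a rest [i * b] forces [a = b]. *)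
Lemma unmixed_decs x : unmixed -> x \in decs ->
  (exists a b, [/\ a \in gens, b \in gens, a < b & x = a + b]) \/
  (exists a i, [/\ a \in gens, 1 < i <= top a & x = i * a]).
Proof.
move=> nm; elim/ltn_ind: x => x IH; rewrite mem_decs => /andP[np Ax].
have [a [y [pa Aa Ay e]]] := apery_decomp Ax np.
have ga : a \in gens by rewrite mem_gens pa.
case: (boolP (prim y)) => py.
  have gy : y \in gens by rewrite mem_gens py.
  case: (ltngtP a y) => h.
  - by left; exists a, y.
  - by left; exists y, a; rewrite addnC.
  - right; exists a, 2; split=> //; last by rewrite e -h mul2n addnn.
    by rewrite /= leq_top // mul2n -addnn {2}h -e.
have /IH : y < x by have := apery_gt Aa; rewrite e; arith.
rewrite mem_decs py Ay => /(_ isT)[[b [d [gb gd bd ey]]]|[b [i [gb it ey]]]].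
  move: gb gd; rewrite !mem_gens => /andP[pb Ab] /andP[pd Ad].
  have [] := nm a b d pa pb pd Aa Ab Ad; first by rewrite -addnA -ey -e.
  by move=> _ bd'; rewrite bd' ltnn in bd.
move: gb; rewrite mem_gens => /andP[pb Ab].
have Sb : S b by case/and3P: Ab.
have [] := nm a b b pa pb pb Aa Ab Ab.
  apply: (@apery_summand ((i - 2) * b)).
  - by apply: SD => //; apply: semigroup_aperyD.
  - by have := apery_gt Aa; arith.
  - exact: semigroup_mul.
  have -> : a + b + b + (i - 2) * b = x.
    rewrite e ey -{2}(subnKC (proj1 (andP it))) mulnDl.
    by move: ((i - 2) * b); clear; lia.
  by [].
move=> ab _; subst b; right; exists a, i.+1; split=> //; last by rewrite e ey mulSn.
rewrite leq_top ?andbT; last by rewrite mulSn -ey -e.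
by case/andP: it => h _; apply: leq_trans h _.
Qed.

(** Each element lies in [(size s).-1] unordered pairs, and [a < b] selects one order of each. *)
Lemma sum_pairs (s : seq nat) (F : nat -> nat) : uniq s ->
  \sum_(a <- s) \sum_(b <- s | a < b) (F a + F b) = (size s).-1 * \sum_(a <- s) F a.
Proof.
move=> us.
transitivity (\sum_(a <- s) \sum_(b <- s | b != a) F a).
  under eq_bigr do rewrite big_split.
  rewrite big_split /= [X in _ + X](exchange_big_dep predT) //= -big_split /=.
  apply: eq_bigr => a _; rewrite [RHS](bigID (fun b => a < b)) /=.
  by congr (_ + _); apply: eq_bigl => b; case: ltngtP.
rewrite big_distrr /= big_seq [RHS]big_seq; apply: eq_bigr => a sa.
rewrite -big_filter big_const_seq count_predT iter_addn_0 mulnC; congr (_ * _).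
by rewrite -rem_filter // size_rem.
Qed.

Lemma unmixed_bound : unmixed -> 1 < size gens ->
  depth * size decs <= (size gens).+1 * weight + rho.
Proof.
move=> nm k2; pose g := gens.
have gP a : a \in g -> prim a /\ apery a by rewrite mem_gens => /andP.
have ug : uniq g by rewrite filter_uniq ?uniq_aps.
have step1 : depth * size decs <= \sum_(x <- decs) (depth - high x) + rho.
  apply: (@leq_trans (\sum_(x <- decs) (depth - high x) + \sum_(x <- decs) high x)).
    rewrite -big_split /= -sum1_size big_distrr /= leq_sum // => x _.
    by have := depth_gt0; case: high; arith.
  rewrite leq_add2l; apply: leq_trans sum_high.
  apply: leq_sum_sub => [|x]; first by rewrite filter_uniq ?uniq_aps.
  by rewrite mem_filter => /andP[].
pose G1 a b := wt a + wt b.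
(* The term [i != 1] is the possible loss: [wtD_top] involves [high (top a * a)], not
   [high (i * a)]. *)
pose G2 a i := wt (i * a) + wt ((top a - i) * a) + (i != 1).
have step2 : \sum_(x <- decs) (depth - high x) <=
    \sum_(a <- g) \sum_(b <- g | a < b) G1 a b +
    \sum_(a <- g) \sum_(1 <= i < top a) G2 a i.
  pose s1 := [seq (a, b) | a <- g, b <- [seq b <- g | a < b]].
  pose s2 := [seq (a, i) | a <- g, i <- index_iota 1 (top a)].
  (* The index 1, free because [a] itself is primitive, encodes [top a * a]. *)
  pose h (y : nat * nat + nat * nat) := match y with
    | inl (a, b) => a + b
    | inr (a, i) => if i == 1 then top a * a else i * a end.
  pose G (y : nat * nat + nat * nat) := match y with
    | inl (a, b) => G1 a b | inr (a, i) => G2 a i end.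
  have -> : \sum_(a <- g) \sum_(b <- g | a < b) G1 a b +
      \sum_(a <- g) \sum_(1 <= i < top a) G2 a i =
      \sum_(y <- map inl s1 ++ map inr s2) G y.
    rewrite big_cat /= !big_map !big_allpairs_dep /=; congr (_ + _).
    by apply: eq_bigr => a _; rewrite big_filter.
  apply: (leq_sum_cover (g := h)); first by rewrite filter_uniq ?uniq_aps.
  move=> x /[dup]; rewrite {1}mem_decs => /andP[_ Ax].
  case/(unmixed_decs nm) => [[a [b [ga gb ab e]]]|[a [i [ga /andP[i1 it] e]]]].
    exists (inl (a, b)).
      rewrite mem_cat map_f //; apply/allpairsPdep; exists a, b; split=> //.
      by rewrite mem_filter ab.
    split=> //; rewrite leq_subLR addnC e; apply: wtD; by rewrite -e.
  have [_ Aa] := gP a ga.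
  have inr_mem j : 0 < j < top a -> inr (a, j) \in map inl s1 ++ map inr s2.
    move=> hj; rewrite mem_cat orbC map_f //; apply/allpairsPdep.
    by exists a, j; rewrite mem_index_iota.
  case: (ltngtP i (top a)) it => // [it _|it _].
    exists (inr (a, i)); first by rewrite inr_mem // it (ltn_trans _ i1).
    rewrite /h /G /G2 (gtn_eqF i1); split=> //; rewrite leq_subLR.
    have := wtD_top Aa (i := i); rewrite it (ltn_trans _ i1) // => /(_ isT).
    by case: (high (top a * a)); case: (high x); clear; lia.
  have t1 : 1 < top a by rewrite -it.
  exists (inr (a, 1)); first by rewrite inr_mem.
  rewrite /h /G /G2 eqxx -it -e; split=> //; rewrite leq_subLR.
  have := wtD_top Aa (i := 1); rewrite t1 => /(_ isT).
  by rewrite -it -e; clear; lia.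
have step3 a : a \in g -> \sum_(1 <= i < top a) G2 a i <=
    2 * wt a + (size g).+1 * \sum_(2 <= i < top a) wt (i * a).
  move=> ga; have [_ Aa] := gP a ga.
  case: (ltnP 1 (top a)) => t1; last by rewrite big_geq.
  rewrite /G2 2!big_split /= sum_wt_rev !(big_ltn t1) mul1n /= add0n.
  (* Each [i * a] with [1 < i < top a] has positive weight, so it can pay its loss as a third
     charge, within [(size g).+1 >= 3]. *)
  have : \sum_(2 <= i < top a) (i != 1) <= \sum_(2 <= i < top a) wt (i * a).
    rewrite big_nat_cond [leqRHS]big_nat_cond leq_sum // => i /andP[/andP[i2 it] _].
    by apply: leq_trans (leq_b1 _) (wt_lt_top Aa _); rewrite it (ltn_trans _ i2).
  move: (\sum_(2 <= i < top a) _) (\sum_(2 <= i < top a) _) k2; rewrite -/g.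
  by move: (size g) (wt a); clear; nia.
have step4 : \sum_(a <- g) wt a +
    \sum_(a <- g) \sum_(2 <= i < top a) wt (i * a) <= weight.
  (* The [maxn 2] keeps the index 1 when [top a = 1]. *)
  pose s := [seq i * a | a <- g, i <- index_iota 1 (maxn 2 (top a))].
  have -> : \sum_(a <- g) wt a + \sum_(a <- g) \sum_(2 <= i < top a) wt (i * a) =
      \sum_(x <- s) wt x.
    rewrite big_allpairs_dep -big_split; apply: eq_bigr => a _.
    rewrite [RHS]big_ltn ?leq_max // mul1n; congr (_ + _).
    by case: (leqP (top a) 2) => // h; rewrite !big_geq.
  have range a i : a \in g -> i \in index_iota 1 (maxn 2 (top a)) ->
      i = 1 \/ 1 < i < top a.
    by move=> _; rewrite mem_index_iota; clear; lia.
  apply: leq_weight; last first.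
    move=> _ /allpairsPdep[a [i [ga /(range _ _ ga) hi ->]]].
    have [_ Aa] := gP a ga.
    apply: apery_le_top => //; have := top_gt0 Aa; move: hi; clear; lia.
  apply: allpairs_uniq_dep => // [a _|]; first exact: iota_uniq.
  move=> u v /allpairsPdep[a [i [ga hi ->]]] /allpairsPdep[b [j [gb hj ->]]] /= e.
  have [pa Aa] := gP a ga; have [pb Ab] := gP b gb.
  have aux a' b' i' : prim a' -> apery b' -> 1 < i' < top b' -> a' = i' * b' -> False.
    move=> pa' Ab' /andP[i1 it]; rewrite -(prednK (ltnW i1)) mulSn.
    apply: (prim_neqD pa' Ab'); apply: (apery_le_top Ab').
    by move: i1 it; clear; lia.
  have eab : a = b.
    case: (range _ _ ga hi) (range _ _ gb hj) => [i1|ir] [j1|jr].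
    - by move: e; rewrite i1 j1 !mul1n.
    - by rewrite i1 mul1n in e; case: (aux a b j).
    - by rewrite j1 mul1n in e; case: (aux b a i).
    (* If [i * a = j * b], then the Apery element [i.+1 * a] contains the sum [a + b + b]. *)
    have [|//] := nm a b b pa pb pb Aa Ab Ab.
    have Sb : S b by case/and3P: Ab.
    apply: (@apery_summand ((j - 2) * b)).
    - by apply: SD => //; apply: semigroup_aperyD.
    - by have := apery_gt Aa; arith.
    - exact: semigroup_mul.
    have -> : a + b + b + (j - 2) * b = i.+1 * a.
      rewrite mulSn e -{2}(subnKC (proj1 (andP jr))) mulnDl.
      by move: ((j - 2) * b); clear; lia.
    by apply: apery_le_top => //; case/andP: ir.
  subst b; congr (Tagged _ _); apply/eqP.
  by rewrite -(eqn_pmul2r (ltn_trans m_gt0 (apery_gt Aa))) e.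
have {}step3 : \sum_(a <- g) \sum_(1 <= i < top a) G2 a i <=
    2 * \sum_(a <- g) wt a +
    (size g).+1 * \sum_(a <- g) \sum_(2 <= i < top a) wt (i * a).
  rewrite !big_distrr -big_split /= big_seq [leqRHS]big_seq.
  exact: leq_sum.
(* A primitive is charged [(size g).-1] times by pairs and twice by its multiples, [(size g).+1]
   times in all. *)
rewrite /G1 sum_pairs // in step2.
move: step1 step2 step3 step4 k2; rewrite -/g.
move: (\sum_(a <- g) wt a) (\sum_(a <- g) \sum_(2 <= i < top a) _).
move: (\sum_(a <- g) \sum_(1 <= i < top a) _) (\sum_(x <- decs) _) (depth * _).
by move: (size g) weight; clear; nia.
Qed.

(** * At most one primitive other than [m] *)

Lemma single_bound : size gens <= 1 ->
  depth * size decs <= (size gens).+1 * weight + rho.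
Proof.
move=> k1.
have [->|] := eqVneq decs [::]; first by rewrite muln0.
case Ed : {1}decs => [//|x0 s0] _.
have : x0 \in decs by rewrite Ed inE eqxx.
rewrite mem_decs => /andP[np0 A0]; have [a [_ [pa Aa _ _]]] := apery_decomp A0 np0.
have ga : a \in gens by rewrite mem_gens pa.
have gE : gens = [:: a].
  by case: gens k1 ga => [|b [|]] //; rewrite inE => _ /eqP->.
have nm : unmixed.
  have one b : prim b -> apery b -> b = a.
    move=> pb Ab; have : b \in gens by rewrite mem_gens pb.
    by rewrite gE inE => /eqP.
  by move=> b1 b2 b3 p1 p2 p3 A1 A2 A3 _; rewrite (one b1) // (one b2) // (one b3).
pose t := top a.
have a0 : 0 < a by apply: ltn_trans m_gt0 (apery_gt Aa).
have sd : size decs <= t.-1.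
  rewrite -[leqRHS](size_iota 2) -[leqRHS](size_map (muln^~ a)).
  apply: uniq_leq_size; first by rewrite filter_uniq ?uniq_aps.
  move=> x /(unmixed_decs nm) [[b [d [gb gd bd _]]]|[b [i [gb it ->]]]].
    by move: gb gd bd; rewrite gE !inE => /eqP-> /eqP->; rewrite ltnn.
  move: gb it; rewrite gE inE => /eqP-> it; apply/mapP; exists i => //.
  by rewrite mem_iota; move: it; rewrite /t; clear; lia.
pose bad i := wt (i * a) + wt ((t - i) * a) < depth.
(* By [weak_res], the values [res (i * a)] at bad indices are distinct and below [rho]. *)
have bad_rho : \sum_(1 <= i < t) bad i <= rho.
  have -> : \sum_(1 <= i < t) bad i = size [seq i <- index_iota 1 t | bad i].
    rewrite size_filter -sum1_count [RHS]big_mkcond.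
    by apply: eq_bigr => i _; case: bad.
  have Ai i : 0 < i < t -> apery (i * a).
    by move=> h; apply: apery_le_top => //; move: h; rewrite /t; clear; lia.
  rewrite -(size_map (fun i => res (i * a))) -[leqRHS](size_iota 0).
  apply: uniq_leq_size.
    rewrite map_inj_in_uniq ?filter_uniq ?iota_uniq // => i j.
    rewrite !mem_filter !mem_index_iota => /andP[_ hi] /andP[_ hj].
    by move/(res_inj (Ai _ hi) (Ai _ hj))/eqP; rewrite eqn_pmul2r // => /eqP.
  move=> _ /mapP[i + ->]; rewrite mem_filter mem_index_iota => /andP[bi hi].
  rewrite mem_iota /= add0n; apply: leq_ltn_trans (leq_addr _ _) _.
  apply: weak_res bi; [|exact: Ai|apply: Ai]; last by move: hi; clear; lia.
  rewrite -mulnDl subnKC; last by move: hi; clear; lia.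
  exact: apery_top.
(* Summing over all splittings of [t * a] counts every [i * a] twice, matching [|P| = 2]. *)
have edges : t.-1 * depth <= 2 * \sum_(1 <= i < t) wt (i * a) + \sum_(1 <= i < t) bad i.
  rewrite mul2n -addnn -{2}sum_wt_rev -!big_split /= -subn1 -sum_nat_const_nat.
  rewrite big_nat_cond [leqRHS]big_nat_cond leq_sum // => i /andP[hi _].
  have := wtD_top Aa hi; rewrite -/t /bad; case: ltnP; case: high; clear; lia.
have wW : \sum_(1 <= i < t) wt (i * a) <= weight.
  rewrite -(big_map (muln^~ a) xpredT wt); apply: leq_weight.
    rewrite map_inj_uniq ?iota_uniq // => i j /eqP.
    by rewrite eqn_pmul2r // => /eqP.
  move=> _ /mapP[i + ->]; rewrite mem_index_iota => hi.
  by apply: apery_le_top => //; move: hi; rewrite /t; clear; lia.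
rewrite gE /=; move: sd bad_rho edges wW.
move: (\sum_(1 <= i < t) wt _) (\sum_(1 <= i < t) _) weight (size decs) depth.
by clear; nia.
Qed.

(** * Combination of the cases *)

Lemma dec_bound : size decs <= 2 * (size gens).+1 ->
  depth * size decs <= (size gens).+1 * weight + rho.
Proof.
move=> d2; have [k1|k2] := leqP (size gens) 1; first exact: single_bound.
case: (boolP (has (fun a => has (fun b => (a != b) && apery (a + a + b)) gens) gens)).
  case/hasP=> a; rewrite mem_gens => /andP[pa Aa] /hasP[b].
  rewrite mem_gens => /andP[pb Ab] /andP[ab Aaab].
  exact: (@mixed_bound a b).
move/hasPn => nm2.
have {}nm2 a b : prim a -> prim b -> apery a -> apery b -> apery (a + a + b) -> a = b.
  move=> pa pb Aa Ab A; have /nm2/hasPn : a \in gens by rewrite mem_gens pa.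
  by move/(_ b); rewrite mem_gens pb Ab A /= andbT => /(_ isT)/negPn/eqP.
have [heavy|light] := leqP (2 * depth) weight; first exact: size_decs_heavy.
apply: unmixed_bound => // a b e pa pb pe Aa Ab Ae A.
have [eab|ab] := eqVneq a b.
  by subst b; split=> //; apply: nm2.
have [ebe|be] := eqVneq b e.
  subst e; case/eqP: ab; apply/esym/nm2 => //.
  by rewrite addnC addnA.
have [eae|ae] := eqVneq a e.
  by subst e; case/eqP: ab; apply: nm2; rewrite // addnAC.
by have := distinct_triple_heavy pa pb pe Aa Ab Ae ab be ae A; rewrite leqNgt light.
Qed.

End Apery.

(* P and L are given as duplicate-free lists enumerating exactly the minimal
   generating set and the set L = {s in S : s < c}; |P| = size P, |L| = size L.
   The hypothesis |P| >= m/3 is written 3|P| >= m. *)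
Theorem theorem1p1 (S : pred nat) (m c : nat) (P L : seq nat) :
  numerical_semigroup S ->
  is_multiplicity S m ->
  is_conductor S c ->
  uniq P -> (forall x, x \in P <-> primitive S x) ->
  uniq L -> (forall x, x \in L <-> (S x /\ x < c)) ->
  m <= 3 * size P ->
  c <= size P * size L.
Proof.
move=> [S0 SD _] [m_gt0 Sm m_min] [Sc _] uP PP uL LP m3.
have [->//|c_gt0] := posnP c.
have hP : size P = (size (gens m c S)).+1 by apply: size_prims.
have hm : (size (gens m c S)).+1 + size (decs m c S) = m by apply: size_gens_decs.
have hL : depth m c + weight m c S <= size L.
  by apply: size_small => // x Sx xc; apply/LP.
have hd : size (decs m c S) <= 2 * (size (gens m c S)).+1 ->
    depth m c * size (decs m c S) <= (size (gens m c S)).+1 * weight m c S + rho m c.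
  exact: dec_bound.
have hq : depth m c * m = c + rho m c by apply: depthE.
(* With [q = depth], [c = q |P| + q d - rho <= |P| (q + W)]; the hypothesis on [m] says
   [d <= 2 |P|]. *)
rewrite hP in m3 *; move: hm hL hq m3 hd; clear.
move: (size (gens _ _ _)) (size (decs _ _ _)) (weight _ _ _).
move: (depth _ _) (rho _ _) (size L).
nia.
Qed.
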